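(* Let $\pi$ be a non-empty permutation in $\mathcal{S}(1-32-4)$ and let $k=\ell(\pi)$, the number of right-to-left maxima of $\pi$ to the right of $1$. Let $\vartheta(\pi)$ be the set of all $\sigma\in\mathcal{S}(1-32-4)$ with $|\sigma|=|\pi|+1$ and $\rho(\sigma)=\pi$, where $\rho$ is the reduction operator defined in the context, and let $\pi^{(k)}$, $\pi^{(i,j)}$, $\pi^{[p]}$ be the permutations defined in the context. (i) If $k=0$, then $\vartheta(\pi)=\{\pi^{(0)},\pi^{[1]}\}$. (ii) If $k\geq 1$, then $\vartheta(\pi)=\{\pi^{(k)},\,\pi^{(i,j)},\,\pi^{[p]} : 0\leq i\leq k-1,\ 1\leq j\leq i+1,\ 1\leq p\leq k+1\}$. (iii) The map $\ell$ is an $\Omega$-labelling of the generating tree $\mathcal{T}_{\vartheta}$, where $\Omega$ is the succession rule $$\begin{cases}(0)\\ (k)\leadsto (0)(1)^{2}(2)^{3}\cdots(k)^{k+1}(k+1).\end{cases}$$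
   Context: **Permutations and the pattern.** A permutation of length $n$ is a word $\pi=\pi_1\cdots\pi_n$ in which every letter of $[n]=\{1,\dots,n\}$ appears exactly once; $|\pi|=n$. An occurrence of the vincular pattern $1-32-4$ in $\pi$ is a choice of indices $a<b<b+1<c$ with $\pi_a<\pi_{b+1}<\pi_b<\pi_c$ (the letters playing the roles of $3$ and $2$ must be adjacent). $\mathcal{S}(1-32-4)$ is the set of all permutations with no such occurrence. **Label.** A right-to-left maximum of $\pi$ is an entry larger than all entries to its right. For non-empty $\pi$, $\ell(\pi)$ is the number of right-to-left maxima of $\pi$ located strictly to the right of the entry $1$. **Decomposition.** Every non-empty $\pi\in\mathcal{S}(1-32-4)$ can be written uniquely as $$\pi=m_{1}\,\ell_{11}\cdots\ell_{1k_{1}}\;m_{2}\,\ell_{21}\cdots\ell_{2k_{2}}\;\cdots\; m_{h}\,\ell_{h1}\cdots\ell_{hk_{h}},$$ where $m_1>\dots>m_h=1$ are the left-to-right minima of $\pi$ (entries smaller than all entries to their left), each $k_i\ge 0$, and the $\ell_{ij}$ are non-empty increasing words (blocks of consecutive entries) with $\max(\ell_{ij})>\max(\ell_{i(j+1)})$ for $1\le j\le k_i-1$. One has $k_h=\ell(\pi)$. **Reduction operator $\rho$.** Let $\sigma\in\mathcal{S}(1-32-4)$ have length $n\ge 2$, with its unique decomposition $\sigma=m_{1}\ell_{11}\cdots\ell_{1k_{1}}\cdots m_{h}\ell_{h1}\cdots\ell_{hk_{h}}$, where $m_1>\dots>m_h=1$ are the left-to-right minima of $\sigma$, each $k_i\ge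 0$, and the $\ell_{ij}$ are non-empty increasing words with $\max(\ell_{ij})>\max(\ell_{i(j+1)})$ for $1\le j\le k_i-1$. The permutation $\rho(\sigma)$, of length $n-1$ and again in $\mathcal{S}(1-32-4)$, is defined as follows. - If $2$ occurs to the left of $1$ in $\sigma$ (so $h\ge2$ and $m_{h-1}=2$): delete $1$; rearrange the words $\ell_{(h-1)1},\dots,\ell_{(h-1)k_{h-1}},\ell_{h1},\dots,\ell_{hk_h}$, which now follow $2$, so that their maxima are decreasing from left to right (each word kept intact); then subtract $1$ from every entry. - If $2$ occurs to the right of $1$ in $\sigma$: then $2$ is the first letter of some $\ell_{hi}$. Delete $1$, move $2$ to the position previously occupied by $1$ (i.e. swap $1$ and $2$, then delete $1$), and subtract $1$ from every entry. **Expansions.** Let $\pi\in\mathcal{S}(1-32-4)$ be non-empty, with its unique decomposition $\pi=m_{1}\ell_{11}\cdots\ell_{1k_{1}}\cdots m_{h}\ell_{h1}\cdots\ell_{hk_{h}}$, where $m_1>\dots>m_h$ are the left-to-right minima of $\pi$, each $k_i\ge 0$, and the $\ell_{ij}$ are non-empty increasing words with $\max(\ell_{ij})>\max(\ell_{i(j+1)})$ for $1\le j\le k_i-1$, $m_h=1$ and $k=k_h=\ell(\pi)$. Let $P=m_{1}\ell_{11}\cdots\ell_{1k_{1}}\cdots m_{h-1}\ell_{(h-1)1}\cdots\ell_{(h-1)k_{h-1}}$ be the part of $\pi$ before the entry $1$ (empty if $h=1$). ''Normalizing'' a word on the letters $0,1,\dots,|\pi|$ means adding $1$ to each letter. - $\pi^{(k)}$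 is the normalization of $P\,1\,0\,\ell_{h1}\cdots\ell_{hk}$. - For $k\ge1$, $0\le i\le k-1$ and $1\le j\le i+1$, $\pi^{(i,j)}$ is the normalization of $$P\,1\,\ell_{h1}\cdots\ell_{h(k-i-1)}\;\ell_{h(k-i+j-1)}\;0\;\ell_{h(k-i)}\cdots\widehat{\ell_{h(k-i+j-1)}}\cdots\ell_{hk},$$ where the hat means that the word is omitted. - For $1\le p\le k$, $\pi^{[p]}$ is the normalization of $P\,0\,\ell_{h1}\cdots\ell_{h(p-1)}\,1\,\ell_{hp}\cdots\ell_{hk}$. - $\pi^{[k+1]}$ is the normalization of $P\,0\,\ell_{h1}\cdots\ell_{hk}\,1$. **Generating tree and labelling.** $\mathcal{T}_{\vartheta}$ is the rooted tree whose nodes are the non-empty permutations in $\mathcal{S}(1-32-4)$, whose root is the permutation $1$ of length one, and in which the set of children of a node $\pi$ is $\vartheta(\pi)$. The map $\ell$ is an $\Omega$-labelling of $\mathcal{T}_\vartheta$ if the root has label $0$ and every node with label $k$ has, for each $0\le i\le k$, exactly $i+1$ children with label $i$, has exactly one child with label $k+1$, and has no other children (exponents in $\Omega$ denote multiplicities). *)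

(* Defs.v *)
From mathcomp Require Import all_boot finmap zify.

Set Implicit Arguments.
Unset Strict Implicit.
Unset Printing Implicit Defensive.

(* Permutations are words over nat; positions in a word are numbered from 0. *)
Definition is_permutation (w : seq nat) : bool := perm_eq w (iota 1 (size w)).

Definition occurs_1_32_4 (w : seq nat) (a b c : nat) : bool :=
  [&& a < b, b.+1 < c & c < size w] &&
  [&& nth 0 w a < nth 0 w b.+1, nth 0 w b.+1 < nth 0 w b
    & nth 0 w b < nth 0 w c].

Definition avoids_1_32_4 (w : seq nat) : bool :=
  let positions := iota 0 (size w) in
  ~~ has (fun a => has (fun b => has (occurs_1_32_4 w a b) positions) positions)
       positions.

Definition S_1_32_4 : pred (seq nat) :=
  [pred w | is_permutation w && avoids_1_32_4 w].

Definition S_nonempty : pred (seq nat) :=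
  [pred w | (w \in S_1_32_4) && (w != [::])].

(* The number of right-to-left maxima strictly to the right of the entry 1. *)
Definition ell (w : seq nat) : nat :=
  count (fun i => (index 1 w < i) &&
                  all (fun x => x < nth 0 w i) (drop i.+1 w))
    (iota 0 (size w)).

Definition lr_minima (w : seq nat) : seq nat :=
  [seq nth 0 w i | i <- iota 0 (size w)
                 & all (fun x => nth 0 w i < x) (take i w)].

Definition max_word (l : seq nat) : nat := foldr maxn 0 l.

(* The list [:: (m_1, [:: l_11; ...; l_1k_1]); ...; (m_h, ...)] *)
Definition blocks := seq (nat * seq (seq nat)).

Definition word_of (D : blocks) : seq nat :=
  flatten [seq mL.1 :: flatten mL.2 | mL <- D].

Definition is_decomposition (w : seq nat) (D : blocks) : bool :=
  [&& w == word_of D,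
      unzip1 D == lr_minima w
    & all (fun mL => all (fun l => (l != [::]) && sorted ltn l) mL.2 &&
                     sorted gtn (map max_word mL.2)) D].

(* The decomposition, computed by cutting at the left-to-right minima and then
   splitting each piece into its maximal increasing runs; lemma decomposeP
   shows that on S_1_32_4 this is the unique D with is_decomposition w D. *)
Fixpoint runs (s : seq nat) : seq (seq nat) :=
  if s is x :: s' then
    if runs s' is (y :: r) :: R then
      if x < y then (x :: y :: r) :: R else [:: x] :: (y :: r) :: R
    else [:: [:: x]]
  else [::].

(* The entries of s up to the first one below m, followed by the pairs (left-
   to-right minimum, entries up to the next one) of what remains. *)
Fixpoint cut (m : nat) (s : seq nat) : seq nat * seq (nat * seq nat) :=
  if s is x :: s' then
    if x < m then let (t, E) := cut x s' in ([::], (x, t) :: E)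
    else let (t, E) := cut m s' in (x :: t, E)
  else ([::], [::]).

Definition decompose (w : seq nat) : blocks :=
  if w is m :: s then
    let (t, E) := cut m s in [seq (p.1, runs p.2) | p <- (m, t) :: E]
  else [::].

Fixpoint lr_minima_below (m : nat) (s : seq nat) : seq nat :=
  if s is x :: s' then
    if x < m then x :: lr_minima_below x s' else lr_minima_below m s'
  else [::].

Lemma lr_minima_cons m s : lr_minima (m :: s) = m :: lr_minima_below m s.
Proof.
pose F (Q : nat -> seq nat -> bool) w :=
  [seq nth 0 w i | i <- iota 0 (size w) & Q (nth 0 w i) (take i w)].
have FS Q x w : F Q (x :: w) =
    (if Q x [::] then [:: x] else [::]) ++ F (fun z t => Q z (x :: t)) w.
  rewrite /F /= -[1]/(1 + 0) iotaDl filter_map.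
  by case: ifP => _ /=; rewrite -map_comp.
have eqF Q Q' w : (forall z t, Q z t = Q' z t) -> F Q w = F Q' w.
  by move=> HQ; rewrite /F; congr map; apply: eq_filter => i /=.
have gen w : forall m', F (fun z t => (z < m') && all (fun x => z < x) t) w =
    lr_minima_below m' w.
  elim: w => //= x w IH m'; rewrite FS /= andbT.
  case: ifP => xm /=; rewrite -IH; [congr cons|]; apply: eqF => z t; lia.
by rewrite -[lr_minima _]/(F (fun z t => all (fun x => z < x) t) (m :: s)) FS -gen.
Qed.

Lemma mem_lr_minima_below m s : {subset lr_minima_below m s <= s}.
Proof.
elim: s m => //= x s IH m y; rewrite in_cons; case: ifP => _.
  by rewrite in_cons => /predU1P[->|/IH->]; rewrite ?eqxx ?orbT.
by move/IH->; rewrite orbT.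
Qed.

Lemma flatten_runs s : flatten (runs s) = s.
Proof.
elim: s => //= x s IH.
case E: (runs s) IH => [|[|y r] R] /= IH; first by rewrite -IH.
  suff: all (fun l => l != [::]) (runs s) by rewrite E.
  elim: (s) => //= z s' IH'.
  by case: (runs s') IH' => [|[|? ?] ?] //=; case: ifP.
by case: ifP => /= _; rewrite -IH.
Qed.

Lemma runs_increasing s :
  all (fun l => (l != [::]) && sorted ltn l) (runs s).
Proof.
elim: s => //= x s; case: (runs s) => [|[|y r] R] //=.
by case: ifP => //= -> /andP[-> ->].
Qed.

Lemma max_word_lt x l : (forall z, z \in l -> z < x) -> 0 < x -> max_word l < x.
Proof.
elim: l => //= y l IH Hl Hx.
have := Hl y (mem_head _ _); have := IH _ Hx.
by move=> /(_ (fun z Hz => Hl z (mem_behead (s := y :: l) Hz))); lia.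
Qed.

Lemma runs_max s : uniq s ->
  (forall B x y C z E, s = B ++ x :: y :: C ++ z :: E -> y < x -> x < z ->
     False) ->
  sorted gtn (map max_word (runs s)).
Proof.
elim: s => //= x s IH /andP[xs us] H.
have {}IH : sorted gtn (map max_word (runs s)).
  by apply: IH => // B x' y' C z E Es; apply: (H (x :: B) x' y' C z E); rewrite Es.
have := flatten_runs s; have := runs_increasing s.
case: (runs s) IH => [|[|y r] R] //= IH _ Es.
case: ifP => [xy|/negbT yx] /=.
  have -> : maxn x (maxn y (foldr maxn 0 r)) = maxn y (foldr maxn 0 r) by lia.
  exact: IH.
rewrite IH andbT maxn0.
have lxy : y < x.
  have: y != x by apply: contraNneq xs => <-; rewrite -Es mem_head.
  by move: yx; rewrite -leqNgt leq_eqVlt eq_sym => /orP[/eqP->|//]; rewrite eqxx.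
apply: (@max_word_lt x (y :: r)); last by lia.
move=> z; rewrite in_cons => /predU1P[->//|zr].
rewrite ltnNge; apply/negP; rewrite leq_eqVlt => /predU1P[xz|xz].
  by move: xs; rewrite -Es inE mem_cat xz zr orbT.
case/splitPr: zr Es => C E Es.
by apply: (H [::] x y C z (E ++ flatten R)) => //; rewrite -Es /= -catA.
Qed.

Lemma runs_unique L :
  all (fun l => (l != [::]) && sorted ltn l) L -> sorted gtn (map max_word L) ->
  uniq (flatten L) -> runs (flatten L) = L.
Proof.
elim: L => //= l L IH /andP[/andP[l0 ls] HL] Hm; rewrite cat_uniq.
case/and3P=> _ _ uL.
have {IH} IH := IH HL (path_sorted Hm) uL.
elim: l l0 ls Hm => [//|x l IHl] _ ls Hm /=.
case: l IHl ls Hm => [|y l] IHl ls Hm /=; last first.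
  move: ls => /= /andP[xy ls].
  have Emax : max_word (x :: y :: l) = max_word (y :: l) by rewrite /=; lia.
  have := IHl isT ls; rewrite -Emax => /(_ Hm) /= ->.
  by rewrite xy.
rewrite IH; case: L HL Hm {IHl IH uL} => [//|[|y r] L] //= _.
rewrite maxn0 => /andP[Hm _].
by rewrite ifF //; move: Hm => /=; lia.
Qed.

Lemma avoids_cat A m B x y C z E :
  avoids_1_32_4 (A ++ m :: B ++ x :: y :: C ++ z :: E) ->
  m < y -> y < x -> x < z -> False.
Proof.
set w := A ++ _; move=> av my yx xz; case/negP: av.
pose b := size A + (size B).+1; pose c := b + (size C).+2.
have sw : size w = c + (size E).+1.
  by rewrite /w size_cat /= size_cat /= size_cat /c /b /=; lia.
have na : nth 0 w (size A) = m by rewrite nth_cat ltnn subnn.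
have shift k : nth 0 w (b + k) = nth 0 (x :: y :: C ++ z :: E) k.
  rewrite /w nth_cat ifF; last by rewrite /b; lia.
  rewrite (_ : b + k - size A = (size B + k).+1); last by rewrite /b; lia.
  by rewrite /= nth_cat ifF; [congr nth; lia|lia].
have nb : nth 0 w b = x by rewrite -[b]addn0 shift.
have nb1 : nth 0 w b.+1 = y by rewrite -addn1 shift.
have nc : nth 0 w c = z by rewrite shift /= nth_cat ltnn subnn.
apply/hasP; exists (size A); first by rewrite mem_iota; lia.
apply/hasP; exists b; first by rewrite mem_iota; lia.
apply/hasP; exists c; first by rewrite mem_iota; lia.
by rewrite /occurs_1_32_4 na nb nb1 nc sw my yx xz !andbT /c /b; lia.
Qed.

Lemma cut_word m s :
  (cut m s).1 ++ flatten [seq p.1 :: p.2 | p <- (cut m s).2] = s.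
Proof.
elim: s m => //= x s IH m; case: ifP => _.
  by have := IH x; case: (cut x s) => t E /= ->.
by have := IH m; case: (cut m s) => t E /= ->.
Qed.

Lemma cut_minima m s : unzip1 (cut m s).2 = lr_minima_below m s.
Proof.
elim: s m => //= x s IH m; case: ifP => _.
  by have := IH x; case: (cut x s) => t E /= ->.
by have := IH m; case: (cut m s) => t E /= ->.
Qed.

Lemma cut_ge m s p : p \in (m, (cut m s).1) :: (cut m s).2 ->
  forall x, x \in p.2 -> p.1 <= x.
Proof.
elim: s m p => [|x s IH] m p /=.
  by rewrite inE => /eqP ->.
case: ifP => [xm|/negbT mx].
  have := IH x; case: (cut x s) => t F /= {}IH.
  by rewrite in_cons => /predU1P[->|/IH].
have := IH m; case: (cut m s) => t F /= {}IH.
rewrite in_cons => /predU1P[->|Hp] /=.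
  move=> z; rewrite in_cons => /predU1P[->|Hz]; first by rewrite leqNgt.
  exact: (IH (m, t) (mem_head _ _)).
by apply: IH; rewrite in_cons Hp orbT.
Qed.

Lemma cut_unique m s t D :
  uniq (m :: s) -> s = t ++ word_of D -> lr_minima_below m s = unzip1 D ->
  cut m s = (t, [seq (mL.1, flatten mL.2) | mL <- D]).
Proof.
elim: s m t D => [|x s IH] m t D /=.
  by case: t => //; case: D.
case/and3P; rewrite in_cons negb_or => /andP[mx ms] xs us.
case: t => [|y t] /=.
  case: D => [|[m2 L] D] //= [<-] Es.
  case: ifP => [xm [Em]|xm Em].
    by rewrite (IH x (flatten L) D) //= xs.
  by case/negP: xs; apply: (@mem_lr_minima_below m); rewrite Em mem_head.
case=> <- Es; case: ifP => [xm Em|xm Em]; last by rewrite (IH m t D) //= ms.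
case/negP: xs; rewrite Es mem_cat; apply/orP; right.
have: x \in unzip1 D by rewrite -Em mem_head.
case/mapP=> mL HmL ->; apply/flattenP.
exists (mL.1 :: flatten mL.2); last exact: mem_head.
by apply/mapP; exists mL.
Qed.

Lemma decomposeP w D :
  w \in S_1_32_4 -> is_decomposition w D = (D == decompose w).
Proof.
rewrite inE => /andP[pw av].
have uw : uniq w by rewrite (perm_uniq pw) iota_uniq.
apply/idP/eqP => [/and3P[/eqP Ew /eqP Em /allP HD]|->].
  case: D Ew Em HD => [-> //|[m L] D Ew Em HD].
  case: w Ew Em uw {pw av} => // x s [-> Es].
  rewrite lr_minima_cons => -[Em] us /=.
  rewrite (cut_unique us Es (esym Em)) /=.
  have Hr mL : mL \in (m, L) :: D -> runs (flatten mL.2) = mL.2.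
    move=> HmL; have /andP[H1 H2] := HD _ HmL; apply: runs_unique => //.
    have: uniq (word_of ((m, L) :: D)) by rewrite /word_of /= -/(word_of D) -Es.
    rewrite /word_of; case/splitPr: HmL => D1 D2; rewrite map_cat flatten_cat /=.
    by rewrite cat_uniq /= cat_uniq => /and5P[_ _ _ ].
  rewrite (Hr (m, L) (mem_head _ _)) -map_comp; congr cons.
  rewrite -[LHS]map_id; apply/eq_in_map => -[m' L'] HmL /=.
  by rewrite (Hr (m', L')) // in_cons HmL orbT.
case: w pw av uw => // m s _ av us /=.
have Es := cut_word m s; have Em := cut_minima m s.
have Hge := @cut_ge m s; case: (cut m s) Es Em Hge => t F /= Es Em Hge.
apply/and3P; split.
- rewrite /word_of /= flatten_runs -map_comp /= -{1}Es; apply/eqP.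
  by congr (_ :: _ ++ flatten _); apply: eq_map => p /=; rewrite flatten_runs.
- by rewrite lr_minima_cons -Em /= /unzip1 -map_comp.
rewrite -[X in all _ X]/[seq (p.1, runs p.2) | p <- (m, t) :: F] all_map.
apply/allP => p Hp /=; rewrite runs_increasing /=.
have {}Es : m :: s = flatten [seq p.1 :: p.2 | p <- (m, t) :: F].
  by rewrite /= Es.
have {}Hge := Hge p Hp.
have [A [E {}Es]] : exists A E, m :: s = A ++ p.1 :: p.2 ++ E.
  rewrite Es; case/splitPr: Hp => F1 F2; rewrite map_cat flatten_cat /=.
  by eexists; eexists; reflexivity.
move: us av; rewrite Es => us av {Es}.
move: us; rewrite cat_uniq => /and3P[_ _] /=.
rewrite cat_uniq mem_cat negb_or -andbA => /and4P[pp _ up _].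
apply: runs_max => // B x y C z E' E2.
apply: (@avoids_cat A p.1 B x y C z (E' ++ E)).
  by move: av; rewrite E2 -!catA /= -!catA.
have yp : y \in p.2 by rewrite E2 mem_cat !in_cons eqxx !orbT.
by rewrite ltn_neqAle Hge // andbT; apply: contraNneq pp => ->.
Qed.

(* Used on permutations in S_1_32_4 of length at least 2 only. *)
Definition rho (s : seq nat) : seq nat :=
  if index 2 s < index 1 s then
    let D := decompose s in
    let h := size D in
    let L1 := (nth (0, [::]) D h.-2).2 in
    let L2 := (nth (0, [::]) D h.-1).2 in
    map predn
      (word_of (take h.-2 D) ++
       2 :: flatten (sort (fun l l' => max_word l' <= max_word l) (L1 ++ L2)))
  else
    map predn
      (take (index 1 s) s ++ 2 :: rem 2 (drop (index 1 s).+1 s)).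

(* P, the l_hp (numbered from p = 1) and k, for the decomposition of w. *)
Definition before_one (w : seq nat) : seq nat :=
  word_of (take (size (decompose w)).-1 (decompose w)).

Definition last_blocks (w : seq nat) : seq (seq nat) :=
  (last (0, [::]) (decompose w)).2.

Definition last_block (w : seq nat) (p : nat) : seq nat :=
  nth [::] (last_blocks w) p.-1.

Definition nb_last_blocks (w : seq nat) : nat := size (last_blocks w).

(* The word l_hp ... l_hq, empty if q < p. *)
Definition last_word (w : seq nat) (p q : nat) : seq nat :=
  flatten [seq last_block w r | r <- iota p (q.+1 - p)].

Definition normalize (w : seq nat) : seq nat := map succn w.

(* pi^(k) *)
Definition exp_top (w : seq nat) : seq nat :=
  let k := nb_last_blocks w in
  normalize (before_one w ++ 1 :: 0 :: last_word w 1 k).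

(* pi^(i,j) *)
Definition exp_pair (w : seq nat) (i j : nat) : seq nat :=
  let k := nb_last_blocks w in
  let q := k - i + j - 1 in
  normalize
    (before_one w ++ 1 :: last_word w 1 (k - i - 1) ++ last_block w q ++
     0 :: flatten [seq last_block w r | r <- iota (k - i) i.+1 & r != q]).

(* pi^[p], for 1 <= p <= k + 1 *)
Definition exp_bracket (w : seq nat) (p : nat) : seq nat :=
  let k := nb_last_blocks w in
  normalize (before_one w ++ 0 :: last_word w 1 (p - 1) ++ 1 :: last_word w p k).

Local Open Scope fset_scope.

Definition theta (w : seq nat) : {fset seq nat} :=
  [fset s in permutations (iota 1 (size w).+1)
     | [&& s \in S_1_32_4, size s == (size w).+1 & rho s == w]].

Record generating_tree := GeneratingTree {
  nodes : pred (seq nat);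
  root : seq nat;
  children : seq nat -> {fset seq nat}
}.

Definition T_theta : generating_tree := GeneratingTree S_nonempty [:: 1] theta.

(* A labelling for the rule (0), (k) ~> (0) (1)^2 (2)^3 ... (k)^(k+1) (k+1). *)
Definition is_Omega_labelling (T : generating_tree) (lab : seq nat -> nat) :
    Prop :=
  lab (root T) = 0 /\
  forall w, w \in nodes T ->
    let k := lab w in
    [/\ forall i, i <= k -> #|` [fset s in children T w | lab s == i]| = i.+1,
        #|` [fset s in children T w | lab s == k.+1]| = 1
      & forall s, s \in children T w -> lab s <= k.+1].

Lemma in_theta w s :
  s \in theta w = [&& s \in S_1_32_4, size s == (size w).+1 & rho s == w].
Proof.
rewrite in_fset !inE /= mem_permutations.
case: (boolP (is_permutation s)) => [Hs|]; last by rewrite andbF.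
case: eqP => [Es|]; last by rewrite !andbF.
by move: Hs; rewrite /is_permutation Es => ->.
Qed.

(* Main.v *)
(* Write w = P 1 l_1 ... l_k with the l_i increasing and of decreasing maxima.
   A word w' with rho w' = w is obtained in one of two ways (letters shifted so
   that the new minimum is 0).  If 1 stays to the right of 0, then
   w' = P 0 B 1 C with B C = l_1 ... l_k, and since 1 creates a descent below
   the last letter of B, avoidance forces the cut between B and C to fall
   between two l_i; this gives the k + 1 words exp_bracket.  If 1 stays to the
   left of 0, then w' = P 1 L1 0 L2 where the l_i are distributed over L1 and
   L2, each in order; the descents inside L1 force every word of L1 but the last
   to have a maximum above all of L2, so L1 is empty or is l_1 ... l_c followed
   by a single l_r with r > c.  This gives exp_top and exp_pair.  The label of w'
   is the number of increasing runs to the right of 0. *)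
Require Import Defs.
From mathcomp Require Import all_boot finmap zify.

Set Implicit Arguments.
Unset Strict Implicit.
Unset Printing Implicit Defensive.

(** * Avoidance split at a minimum *)

(* A descent x > y of s above some letter of p or earlier letter of s admits no
   later letter above x in s or X: this is avoidance by s read between a prefix
   with letters p and a suffix with letters X, for descents lying in s only. *)
Fixpoint clean (p X s : seq nat) : bool :=
  if s is x :: t then
    (if t is y :: t' then has (gtn y) p && (y < x) ==> all (geq x) (t' ++ X)
     else true) && clean (x :: p) X t
  else true.

Lemma cleanP p X s :
  reflect (forall A x y C, s = A ++ x :: y :: C -> has (gtn y) (A ++ p) ->
             y < x -> all (geq x) (C ++ X))
          (clean p X s).
Proof.
elim: s p => [|x s IH] p /=; first by left; case.
apply: (iffP andP) => [[Hx /IH Hs] [|a A] x' y C /= [<- Es] Hy yx|H].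
- by move: Hx; rewrite Es Hy yx.
- apply: (Hs A x' y C) => //; move: Hy; rewrite !has_cat /=.
  by case/or3P => ->; rewrite ?orbT.
split.
  case: s H {IH} => // y s H; apply/implyP => /andP[Hy yx].
  exact: (H [::] x y s).
apply/IH => A x' y C Es Hy yx; apply: (H (x :: A) x' y C) => //=.
  by rewrite Es.
by move: Hy; rewrite !has_cat /=; case/or3P => ->; rewrite ?orbT.
Qed.

(** With nothing around the word, [clean] tests each descent, in the roles 3 and 2, against all
    smaller letters before it and all larger ones after it. *)
Lemma avoids_clean w : avoids_1_32_4 w = clean [::] [::] w.
Proof.
apply/idP/cleanP => [av A x y C Ew|H].
  rewrite !cats0 => /hasP[m /= mA my] yx; apply/allP => z zC /=.
  rewrite leqNgt; apply/negP => xz.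
  case/splitPr: mA zC Ew => A1 A2; case/splitPr => C1 C2 Ew.
  by apply: (@avoids_cat A1 m A2 x y C1 z C2) => //; move: av; rewrite Ew -catA.
suff no a b c : ~~ occurs_1_32_4 w a b c.
  by do 3![apply/hasPn => ? _]; exact: no.
apply/negP; case/andP=> /and3P[ab bc cw] /and3P[ay yx xz].
have bw : b <= size w by lia.
have dw : c - b.+2 < size w - b.+2 by lia.
have Ew : w = take b w ++ nth 0 w b :: nth 0 w b.+1 :: drop b.+2 w.
  by rewrite -!drop_nth ?cat_take_drop //; lia.
have := H _ _ _ _ Ew.
suff: nth 0 w c \in drop b.+2 w.
  move=> cD; rewrite !cats0; suff -> : has (gtn (nth 0 w b.+1)) (take b w).
    by move=> /(_ isT yx) /allP /(_ _ cD) /=; lia.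
  apply/hasP; exists (nth 0 w a); rewrite //= -(nth_take 0 ab).
  by apply: mem_nth; rewrite size_takel.
rewrite (_ : c = b.+2 + (c - b.+2)); last by lia.
by rewrite -nth_drop; apply: mem_nth; rewrite size_drop.
Qed.

(** The test sees [X] only as a set and [p] only through which letters of [s] lie above some letter
    of it. Hence a prefix can be exchanged for one letter below all of [s]. *)
Lemma eq_clean p p' X X' s :
  X =i X' -> {in s, forall y, has (gtn y) p = has (gtn y) p'} ->
  clean p X s = clean p' X' s.
Proof.
move=> eX; elim: s p p' => //= x s IH p p' ep.
congr andb; last first.
  by apply: IH => y ys /=; rewrite ep // inE ys orbT.
case: s ep {IH} => // y s ep; rewrite ep ?inE ?eqxx ?orbT //.
by congr implb; apply: eq_all_r => z; rewrite !mem_cat eX.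
Qed.

Lemma clean_map_succ p X s :
  clean (map succn p) (map succn X) (map succn s) = clean p X s.
Proof.
elim: s p => //= x s IH p; rewrite -(IH (x :: p)); congr andb.
by case: s {IH} => //= y s; rewrite -map_cat has_map all_map.
Qed.

(** A letter [m] below all others is never the 4, and a descent ending in [m] has no smaller letter
    before it. To the right of [m] every descent can use [m] as its 1, so the prefix shrinks to
    [[:: m]]; the left part still sees the letters of [s]. *)
Lemma clean_cat_min p X A m s :
  all (ltn m) (p ++ A ++ s) ->
  clean p X (A ++ m :: s) = clean p (s ++ X) A && clean [:: m] X s.
Proof.
elim: A p => [|x A IH] p Hm.
  move: Hm; rewrite all_cat /= => /andP[_ Hs].
  rewrite (_ : (if s is _ :: _ then _ else true) = true); last first.
    case: s Hs => //= y s /andP[my _].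
    by rewrite ltnNge (ltnW my) andbF.
  apply: eq_clean => // y /(allP Hs) /= my.
  by rewrite my.
have {}IH : clean (x :: p) X (A ++ m :: s) =
    clean (x :: p) (s ++ X) A && clean [:: m] X s.
  apply: IH; move: Hm; rewrite /= !all_cat /= !all_cat.
  by case/and4P=> -> -> -> ->.
move: Hm; rewrite !all_cat /= => /and3P[Hp /andP[mx _] _].
rewrite /= IH andbA; congr (_ && _ && _).
case: A {IH} => [|y A] /=.
  (* The descent from [x] to [m] is harmless: no letter of [p] is below [m]. *)
  rewrite (_ : has _ _ = false) //; apply/hasP => -[a /(allP Hp) /=]; lia.
by rewrite !all_cat /= (ltnW mx) /= andbA.
Qed.

(** * Increasing runs and their maxima *)

(** [word_gt] is the order of the blocks in a decomposition, [word_ge] the comparison by which [rho]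
    sorts. *)
Definition word_gt (l l' : seq nat) : bool := max_word l' < max_word l.
Definition word_ge (l l' : seq nat) : bool := max_word l' <= max_word l.
Definition increasing_words (L : seq (seq nat)) : bool :=
  all (fun l => (l != [::]) && sorted ltn l) L.

Lemma word_gt_trans : transitive word_gt.
Proof. by move=> y x z; rewrite /word_gt; lia. Qed.

Lemma word_gt_irr : irreflexive word_gt.
Proof. by move=> x; rewrite /word_gt ltnn. Qed.

Lemma sorted_word_gt L : sorted gtn (map max_word L) = sorted word_gt L.
Proof. by rewrite sorted_map. Qed.

Lemma leq_max_word l x : x \in l -> x <= max_word l.
Proof.
elim: l => //= y l IH; rewrite inE => /predU1P[->|/IH]; lia.
Qed.

Lemma mem_max_word l : l != [::] -> max_word l \in l.
Proof.
elim: l => //= x [_ _|y l /(_ isT) IH _]; first by rewrite maxn0 mem_head.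
by rewrite inE /maxn; case: ifP => _; rewrite ?IH ?eqxx ?orbT.
Qed.

Lemma all_leq_max_word l n : all (geq n) l = (max_word l <= n).
Proof. by elim: l => //= x l ->; rewrite geq_max. Qed.

#[local] Arguments max_word : simpl never.

Lemma runs_neq0 s : (runs s == [::]) = (s == [::]).
Proof.
case: s => //= x s; case: (runs s) => [|[|y r] R] //.
by case: ifP.
Qed.

(** For [L] the runs of a word with distinct letters, these are the runs whose maximum is the top of
    a descent. *)
Definition nonlast (L : seq (seq nat)) := take (size L).-1 L.

Lemma nonlast_cons l L :
  nonlast (l :: L) = if L is [::] then [::] else l :: nonlast L.
Proof. by case: L. Qed.

Lemma runs_cons x y s :
  exists r R, runs (y :: s) = (y :: r) :: R /\
    runs (x :: y :: s) = if x < y then (x :: y :: r) :: R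
                         else [:: x] :: (y :: r) :: R.
Proof.
rewrite [runs (x :: _)]/= -/(runs (y :: s)).
have := runs_neq0 (y :: s); have := flatten_runs (y :: s).
have := runs_increasing (y :: s).
case: (runs (y :: s)) => [|[|z r] R] //= _ [-> _] _.
by exists r, R.
Qed.

Lemma max_word_flatten L : max_word (flatten L) = max_word (map max_word L).
Proof.
elim: L => //= l L; rewrite /max_word /= => <-.
by elim: l => [|x l] /=; rewrite ?max0n // => ->; rewrite maxnA.
Qed.

Lemma sorted_word_gt_cons l L :
  sorted word_gt (l :: L) -> max_word (flatten L) <= max_word l.
Proof.
elim: L l => //= l' L IH l /andP[ll' /IH le'].
rewrite -all_leq_max_word all_cat !all_leq_max_word (ltnW ll') /=.
exact: leq_trans le' (ltnW ll').
Qed.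

(** Descents of [s] are the boundaries between runs, their tops are the run maxima, and [m] serves
    as the 1 for all of them. So each such maximum must dominate the later runs and [X]. *)
Lemma clean_runs m X s : uniq s -> all (ltn m) s ->
  clean [:: m] X s =
  sorted word_gt (runs s) && all (fun l => all (geq (max_word l)) X)
                               (nonlast (runs s)).
Proof.
elim: s => [|x [|y s] IH] //; rewrite [uniq _]/= -/(uniq (y :: s)).
rewrite [all (ltn m) _]/= -/(all (ltn m) (y :: s)) => /andP[xs us] /andP[mx ms].
have xy : x != y by apply: contraNneq xs => ->; rewrite mem_head.
have -> : clean [:: m] X (x :: y :: s) =
    ((y < x) ==> all (geq x) (s ++ X)) && clean [:: m] X (y :: s).
  have /andP[my _] := ms.
  rewrite -[LHS]/(_ && clean [:: x; m] X (y :: s)); congr andb.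
    by rewrite (_ : has _ _ = true) //= orbF.
  by apply: eq_clean => // z /(allP ms) /= mz; rewrite mz orbT.
rewrite (IH us ms); have [r [R [Er ->]]] := runs_cons x y s; rewrite Er.
have Ey : flatten ((y :: r) :: R) = y :: s by rewrite -Er flatten_runs.
case: (ltngtP x y) xy => // [xy|yx] _.
  have Em : max_word (x :: y :: r) = max_word (y :: r).
    by rewrite /max_word /= maxnA (maxn_idPr (ltnW xy)).
  rewrite !nonlast_cons; congr andb; case: (R) => //= l R'.
  by rewrite /word_gt Em.
set l := y :: r; rewrite [nonlast ([:: x] :: _)]nonlast_cons all_cat.
have maxx : max_word [:: x] = x by rewrite /max_word /= maxn0.
rewrite [sorted _ ([:: x] :: _)]/= -/(sorted word_gt (l :: R)).
have [Hs|] := boolP (sorted word_gt (l :: R)); last by rewrite !andbF.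
(* By [Hs] the first run [l] carries the maximum of all that follows [x], so comparing [x] with [l]
   suffices. *)
suff -> : all (geq x) s = word_gt [:: x] l by rewrite /= maxx !andbT andbA.
have <- : all (geq x) (y :: s) = all (geq x) s by rewrite /= (ltnW yx).
have lx : max_word l != x.
  by apply: contraNneq xs => <-; rewrite -Ey mem_cat mem_max_word.
rewrite -Ey /word_gt maxx ltn_neqAle lx all_cat !all_leq_max_word.
by case: leqP => //= /(leq_trans (sorted_word_gt_cons Hs)).
Qed.

(** * Decomposition and labels *)

Lemma cut_above m s : all (leq m) s -> cut m s = (s, [::]).
Proof.
by elim: s => //= x s IH /andP[mx /IH ->]; rewrite ltnNge mx.
Qed.

Lemma cut_cat m0 m A s : m < m0 -> all (ltn m) A -> all (leq m) s ->
  cut m0 (A ++ m :: s) = ((cut m0 A).1, rcons (cut m0 A).2 (m, s)).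
Proof.
move=> mm0 HA Hs; elim: A m0 mm0 HA => [|x A IH] m0 mm0 /=.
  by rewrite mm0 cut_above.
case/andP=> mx HA; case: ifP => xm0; rewrite IH //.
  by case: (cut x A).
by case: (cut m0 A).
Qed.

(** Here [m] is the last left-to-right minimum, so everything after it forms the last piece. *)
Lemma decompose_cat m A s : all (ltn m) A -> all (leq m) s ->
  decompose (A ++ m :: s) = rcons (decompose A) (m, runs s).
Proof.
case: A => [|x A] /=; first by move=> _ /cut_above ->.
case/andP=> mx HA Hs; rewrite cut_cat //; case: (cut x A) => t E /=.
by rewrite map_rcons.
Qed.

Lemma word_of_decompose w : word_of (decompose w) = w.
Proof.
case: w => //= m s; have := cut_word m s; case: (cut m s) => t E /= Es.
rewrite /word_of /= flatten_runs -[in RHS]Es -map_comp.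
by congr (_ :: _ ++ flatten _); apply: eq_map => p /=; rewrite flatten_runs.
Qed.

Lemma before_one_cat A s : all (ltn 1) A -> all (leq 1) s ->
  before_one (A ++ 1 :: s) = A.
Proof.
move=> HA Hs; rewrite /before_one decompose_cat // size_rcons /= -cats1.
by rewrite take_size_cat // word_of_decompose.
Qed.

Lemma last_blocks_cat A s : all (ltn 1) A -> all (leq 1) s ->
  last_blocks (A ++ 1 :: s) = runs s.
Proof. by move=> HA Hs; rewrite /last_blocks decompose_cat // last_rcons. Qed.

Lemma runs_map_succ s : runs (map succn s) = map (map succn) (runs s).
Proof.
elim: s => //= x s ->; case: (runs s) => [|[|y r] R] //=.
by rewrite ltnS; case: ifP.
Qed.

Lemma max_word_map_succ l : l != [::] ->
  max_word (map succn l) = (max_word l).+1.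
Proof.
rewrite /max_word; elim: l => //= x [_ _|y l /(_ isT)]; first by rewrite !maxn0.
by rewrite /= => -> _; rewrite maxnSS.
Qed.

Lemma increasing_words_runs s : increasing_words (runs s).
Proof. exact: runs_increasing. Qed.

Lemma is_permutation_normalize t :
  is_permutation (normalize t) = perm_eq t (iota 0 (size t)).
Proof.
rewrite /is_permutation /normalize size_map -[1]/(1 + 0) iotaDl.
by apply/idP/idP => [/perm_map_inj|/perm_map]; apply; exact: succn_inj.
Qed.

Definition rl_maxima (s : seq nat) : nat :=
  count (fun i => all (fun x => x < nth 0 s i) (drop i.+1 s)) (iota 0 (size s)).

Lemma rl_maxima_cons x s : rl_maxima (x :: s) = all (gtn x) s + rl_maxima s.
Proof.
rewrite /rl_maxima /= drop0; congr (_ + _).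
by rewrite -[1]/(1 + 0) iotaDl count_map; apply: eq_count.
Qed.

Lemma ell_cat A s : 1 \notin A -> ell (A ++ 1 :: s) = rl_maxima s.
Proof.
move=> A1; rewrite /ell index_cat (negPf A1) /= addn0.
rewrite size_cat /= -addSnnS iotaD count_cat /= add0n.
set c1 := count _ _; have -> : c1 = 0.
  apply/eqP; rewrite -leqn0 leqNgt -has_count; apply/hasP => -[i].
  rewrite mem_iota => /andP[_]; rewrite ltnS => Hi /andP[].
  by rewrite ltnNge Hi.
have -> : iota (size A).+1 (size s) = map (addn (size A).+1) (iota 0 (size s)).
  by rewrite -iotaDl addn0.
rewrite count_map; apply: eq_count => i /=.
rewrite addSn ltnS leq_addr /=.
rewrite -cat_rcons -addSn -addnS -(size_rcons A 1) nth_cat drop_cat.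
by rewrite !ltnNge !leq_addr /= !addKn.
Qed.

(** When run maxima decrease, the right-to-left maxima are exactly the last letters of the runs. *)
Lemma rl_maxima_runs s : uniq s -> sorted word_gt (runs s) ->
  rl_maxima s = size (runs s).
Proof.
elim: s => [|x [|y s] IH] // /andP[xs us].
have xy : x != y by apply: contraNneq xs => ->; rewrite mem_head.
have {IH} := IH us; have [r [R [Er ->]]] := runs_cons x y s; rewrite Er.
have Ey : flatten ((y :: r) :: R) = y :: s by rewrite -Er flatten_runs.
rewrite [rl_maxima (x :: _)]rl_maxima_cons.
have E : all (gtn x) (y :: s) = all (geq x) (y :: s).
  apply: eq_in_all => z zs /=; rewrite ltn_neqAle.
  by rewrite (_ : z != x) //; apply: contraNneq xs => <-.
rewrite E -Ey all_leq_max_word /=.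
case: ifP => xy' IH Hs.
  rewrite IH; last first.
    by move: Hs; case: (R) => //= l R'; rewrite /word_gt /max_word /=; lia.
  suff: x < max_word (flatten ((y :: r) :: R)).
    by rewrite ltnNge => /negPf /= ->.
  by apply: leq_trans xy' _; apply: leq_max_word; rewrite mem_head.
have := sorted_word_gt_cons Hs.
rewrite (_ : max_word [:: x] = x) /=; last by rewrite /max_word /= maxn0.
by move=> ->; case/andP: Hs => _ /IH ->.
Qed.

(** All that is used later about a parent word. Cutting at its minimum 1 splits avoidance into a
    condition on P, given the letters after it, and, by [clean_runs], decreasing maxima of the last
    blocks. *)
Lemma S_nonempty_cut w (P := before_one w) (s := flatten (last_blocks w)) :
  w \in S_nonempty ->
  [/\ w = P ++ 1 :: s, all (ltn 1) (P ++ s) & uniq (P ++ s)] /\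
  [/\ clean [::] s P, runs s = last_blocks w & sorted word_gt (last_blocks w)].
Proof.
rewrite !inE => /andP[/andP[pw av] w0].
have w1 : 1 \in w.
  by rewrite (perm_mem pw) mem_iota /=; case: (w) w0.
have uw : uniq w by rewrite (perm_uniq pw) iota_uniq.
have aw : all (leq 1) w.
  by apply/allP => x; rewrite (perm_mem pw) mem_iota => /andP[].
case/splitPr: w1 @P @s pw w0 uw aw av => A t P s pw _.
rewrite uniq_catC /= mem_cat negb_or uniq_catC => /andP[/andP[t1 A1] ut].
rewrite all_cat /= => /andP[aA at_].
have lt1 r : 1 \notin r -> all (leq 1) r -> all (ltn 1) r.
  move=> r1 /allP ar; apply/allP => x xr; have := ar x xr.
  by rewrite [_ x]leq_eqVlt => /predU1P[xx|//]; rewrite xx xr in r1.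
have {}aA := lt1 _ A1 aA; have at1 := lt1 _ t1 at_.
have EP : P = A by rewrite /P before_one_cat.
have EL : last_blocks (A ++ 1 :: t) = runs t by rewrite last_blocks_cat.
have Es : s = t by rewrite /s EL flatten_runs.
rewrite EP Es EL all_cat aA at1 avoids_clean clean_cat_min ?all_cat ?aA //.
rewrite clean_runs // ?cats0; last by move: ut; rewrite cat_uniq => /and3P[].
by case/and3P.
Qed.

Lemma ell_last_blocks w : w \in S_nonempty -> ell w = size (last_blocks w).
Proof.
move=> /S_nonempty_cut[[Ew aw uw] [_ Er Hs]].
move: aw uw; rewrite all_cat cat_uniq => /andP[aP _] /and3P[_ _ us].
rewrite {1}Ew ell_cat; first by rewrite rl_maxima_runs ?Er.
by apply/negP => /(allP aP).
Qed.

(** * The reduction operator *)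

Lemma sort_word_gt L : uniq (map max_word L) -> sorted word_gt (sort word_ge L).
Proof.
move=> uL; rewrite -sorted_word_gt gtn_sorted_uniq_geq.
rewrite (perm_uniq (perm_map _ (permEl (perm_sort _ _)))) uL sorted_map.
by apply: sort_sorted => l l'; rewrite /= /word_ge leq_total.
Qed.

Lemma sorted_uniq_max L : sorted word_gt L -> uniq (map max_word L).
Proof. by rewrite -sorted_word_gt gtn_sorted_uniq_geq => /andP[]. Qed.

Lemma perm_sorted_words L L' :
  perm_eq L L' -> sorted word_gt L -> sorted word_gt L' -> L = L'.
Proof.
move=> /perm_mem eL sL sL'.
exact: (irr_sorted_eq word_gt_trans word_gt_irr sL sL' eL).
Qed.

Lemma sort_words L0 L : perm_eq L0 L -> sorted word_gt L -> sort word_ge L0 = L.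
Proof.
move=> pL sL; apply: perm_sorted_words => //.
  by rewrite perm_sort.
by apply: sort_word_gt; rewrite (perm_uniq (perm_map _ pL)) sorted_uniq_max.
Qed.

(** Each maximum is a letter of its own word, and no two words share a letter. *)
Lemma uniq_max_words L :
  all (fun l => l != [::]) L -> uniq (flatten L) -> uniq (map max_word L).
Proof.
elim: L => //= l L IH /andP[l0 HL]; rewrite cat_uniq => /and3P[_ /hasPn Hl uL].
rewrite IH // andbT; apply/negP => /mapP[l' l'L El].
have: max_word l' \in flatten L.
  by apply/flattenP; exists l' => //; rewrite mem_max_word ?(allP HL).
by move/Hl => /=; rewrite -El mem_max_word.
Qed.

Lemma words_neq0 L : increasing_words L -> all (fun l => l != [::]) L.
Proof. by apply: sub_all => l /andP[]. Qed.

Lemma runs_flatten L : increasing_words L -> sorted word_gt L ->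
  uniq (flatten L) -> runs (flatten L) = L.
Proof. by move=> HL sL; apply: runs_unique; rewrite ?sorted_word_gt. Qed.

(** [rho] sorts while the letters are still raised by one and lowers them afterwards; raising keeps
    the order of the maxima. Empty words are excluded because their maximum is 0 by convention and
    does not grow. *)
Lemma sort_words_map_succ L :
  all (fun l => l != [::]) L -> uniq (map max_word L) ->
  sort word_ge (map (map succn) L) = map (map succn) (sort word_ge L).
Proof.
move=> HL uL; apply: sort_words.
  by rewrite perm_map // perm_sym perm_sort.
have Em : map max_word (map (map succn) (sort word_ge L)) =
    map succn (map max_word (sort word_ge L)).
  rewrite -!map_comp; apply/eq_in_map => l; rewrite mem_sort => lL.
  by rewrite /= max_word_map_succ // (allP HL).
by rewrite -sorted_word_gt Em sorted_map sorted_word_gt sort_word_gt.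
Qed.

(** The first branch of [rho] in unnormalized letters: 0 disappears and the runs on its two sides,
    back to 1, are merged by decreasing maxima. *)
Lemma rho_left A t1 t2 : all (ltn 1) (A ++ t1 ++ t2) -> uniq (t1 ++ t2) ->
  rho (normalize (A ++ 1 :: t1 ++ 0 :: t2)) =
  A ++ 1 :: flatten (sort word_ge (runs t1 ++ runs t2)).
Proof.
rewrite !all_cat => /and3P[aA a1 a2] ut.
have nA x : x <= 1 -> (x \in A) = false.
  by move=> x1; apply/negP => /(allP aA) /=; lia.
have n1 x : x <= 1 -> (x \in t1) = false.
  by move=> x1; apply/negP => /(allP a1) /=; lia.
rewrite /rho /normalize.
set w := A ++ _.
have -> : index 2 (map succn w) = index 1 w by exact: (index_map succn_inj w 1).
have -> : index 1 (map succn w) = index 0 w by exact: (index_map succn_inj w 0).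
rewrite /w !index_cat !nA //= index_cat n1 //= ltn_add2l /=.
(* The last two left-to-right minima are the raised 1 and 0; they are peeled off one at a time. *)
have E : decompose (map succn (A ++ 1 :: t1 ++ 0 :: t2)) =
  rcons (rcons (decompose (map succn A)) (2, runs (map succn t1)))
        (1, runs (map succn t2)).
  rewrite !map_cat /= map_cat /= -cat_cons catA decompose_cat.
  - by rewrite decompose_cat // all_map //; apply: sub_all a1 => x /=; lia.
  - rewrite all_cat /= !all_map; apply/andP.
    by split; [apply: sub_all aA|apply: sub_all a1] => x /=; lia.
  by rewrite all_map; apply: sub_all a2 => x /=; lia.
rewrite E !size_rcons /= !nth_rcons !size_rcons !ltnS !leqnn !ltnn !eqxx /=.
rewrite -!cats1 -catA take_size_cat // word_of_decompose map_cat /=.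
rewrite (mapK succnK) !runs_map_succ -map_cat; congr (_ ++ _ :: _).
rewrite -[sort _ _]/(sort word_ge _) sort_words_map_succ.
  by rewrite -map_flatten (mapK succnK).
  by rewrite all_cat !words_neq0 ?increasing_words_runs.
apply: uniq_max_words; last by rewrite flatten_cat !flatten_runs.
by rewrite all_cat !words_neq0 ?increasing_words_runs.
Qed.

Lemma cat_cons_inj (T : eqType) (x : T) A A' u u' : x \notin A -> x \notin A' ->
  A ++ x :: u = A' ++ x :: u' -> A = A' /\ u = u'.
Proof.
elim: A A' => [|a A IH] [|a' A'] //=; rewrite ?inE ?negb_or.
- by move=> _ _ [->].
- by move=> _ /andP[/eqP xa _] [].
- by move=> /andP[/eqP xa _] _ [] /esym.
by move=> /andP[_ HA] /andP[_ HA'] [-> /(IH _ HA HA')[-> ->]].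
Qed.

Lemma above_notin m x s : all (ltn m) s -> x <= m -> x \notin s.
Proof. by move=> /allP ms xm; apply/negP => /ms /=; rewrite ltnNge xm. Qed.

(** The second branch of [rho] in unnormalized letters: 1 takes the place of 0. *)
Lemma rho_right A t : all (ltn 1) A -> 1 \in t ->
  rho (normalize (A ++ 0 :: t)) = A ++ 1 :: rem 1 t.
Proof.
move=> aA t1; rewrite /rho /normalize; set w := A ++ _.
have -> : index 2 (map succn w) = index 1 w by exact: (index_map succn_inj w 1).
have -> : index 1 (map succn w) = index 0 w by exact: (index_map succn_inj w 0).
rewrite /w !index_cat !(negPf (above_notin aA _)) //= addn0 ltnNge.
rewrite leq_addr /= [map succn _]map_cat take_size_cat ?size_map //=.
rewrite -(cat_rcons 1) drop_size_cat ?size_rcons ?size_map //.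
rewrite map_cat /= (mapK succnK); congr (_ ++ _ :: _).
elim: t t1 {w} => //= x t IH; rewrite inE eqSS eq_sym.
case: eqP => [_ _|_ /= /IH ->] //.
by rewrite (mapK succnK).
Qed.

(** * Children classified by the side of 0 on which 1 lies *)

Lemma normalize_S t :
  (normalize t \in S_1_32_4) = perm_eq t (iota 0 (size t)) && clean [::] [::] t.
Proof.
rewrite inE is_permutation_normalize avoids_clean; congr andb.
exact: (clean_map_succ [::] [::] t).
Qed.

Lemma perm_normalize_cons w t : is_permutation w -> perm_eq t (0 :: w) ->
  perm_eq t (iota 0 (size t)).
Proof.
move=> pw pt; rewrite (perm_size pt) /=.
by apply: perm_trans pt _; rewrite perm_cons.
Qed.

(* The runs L1 between 1 and 0 and L2 to the right of 0 in an avoiding word that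
   rho maps to a word with last blocks L. *)
Definition splits (L1 L2 L : seq (seq nat)) : bool :=
  [&& perm_eq (L1 ++ L2) L, sorted word_gt L1, sorted word_gt L2
    & all (fun l => all (word_ge l) L2) (nonlast L1)].

(** Avoidance is split at 0 and then, in the part before 0, at 1. Descents of [t1] are still
    followed by [t2], which yields the last condition. *)
Lemma clean_left A t1 t2 : all (ltn 1) (A ++ t1 ++ t2) -> uniq (t1 ++ t2) ->
  clean [::] [::] (A ++ 1 :: t1 ++ 0 :: t2) =
  [&& clean [::] (t1 ++ t2) A, sorted word_gt (runs t1),
      sorted word_gt (runs t2)
    & all (fun l => all (word_ge l) (runs t2)) (nonlast (runs t1))].
Proof.
rewrite !all_cat cat_uniq => /and3P[aA a1 a2] /and3P[u1 _ u2].
have sub s : all (ltn 1) s -> all (ltn 0) s by apply: sub_all => x /=; lia.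
rewrite -cat_cons catA clean_cat_min /=; last by rewrite !all_cat /= !sub.
rewrite clean_cat_min ?cats0; last by rewrite /= all_cat aA.
rewrite !clean_runs ?sub // -!andbA; congr (_ && (_ && _)).
rewrite (_ : all (fun l => all _ [::]) _ = true) ?andbT; last exact/allP.
rewrite andbC; congr andb; apply: eq_all => l.
rewrite all_leq_max_word -{1}(flatten_runs t2) max_word_flatten.
by rewrite -all_leq_max_word all_map.
Qed.

(** Merging by decreasing maxima gives back the last blocks exactly when the runs of [t1] and [t2]
    together are those blocks; the rest of [splits] is avoidance. *)
Lemma theta_left w A t1 t2 : w \in S_nonempty -> all (ltn 1) (A ++ t1 ++ t2) ->
  (normalize (A ++ 1 :: t1 ++ 0 :: t2) \in theta w) =
  (A == before_one w) && splits (runs t1) (runs t2) (last_blocks w).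
Proof.
move=> wS at_; have [[Ew aw uw] [cw Er sL]] := S_nonempty_cut wS.
have pw : is_permutation w by move: wS; rewrite !inE => /andP[/andP[]].
set L := last_blocks w in Ew aw uw cw Er sL *.
set P := before_one w in Ew aw uw cw *.
have aP : all (ltn 1) P by move: aw; rewrite all_cat => /andP[].
have aA : all (ltn 1) A by move: at_; rewrite all_cat => /andP[].
rewrite in_theta normalize_S.
apply/idP/andP.
  case/and3P=> /andP[pt ct] _ /eqP.
  have ut : uniq (t1 ++ t2).
    have := perm_uniq pt; rewrite iota_uniq cat_uniq /= => /and3P[_ _ /andP[_]].
    by rewrite !cat_uniq /= negb_or => /and3P[-> /andP[_ ->] /andP[_ ->]].
  move: ct; rewrite clean_left // => /and4P[_ s1 s2 s12].
  rewrite rho_left // [in X in _ = X -> _]Ew.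
  (* Neither prefix contains 1, so both words can be cut at 1 and compared side by side. *)
  case/cat_cons_inj; rewrite ?(above_notin _ (leqnn 1)) //.
  move=> -> Ef; rewrite eqxx; split=> //.
  rewrite /splits s1 s2 s12 !andbT -Er -Ef runs_flatten ?perm_sort //.
  - by rewrite perm_sym perm_sort.
  - by rewrite /increasing_words all_sort all_cat !runs_increasing.
  - apply: sort_word_gt; apply: uniq_max_words; last first.
      by rewrite flatten_cat !flatten_runs.
    by rewrite all_cat !words_neq0 ?increasing_words_runs.
  by rewrite Ef; move: uw; rewrite cat_uniq => /and3P[].
case=> /eqP -> /and4P[pL s1 s2 s12].
have pt : perm_eq (t1 ++ t2) (flatten L).
  by have := perm_flatten pL; rewrite flatten_cat !flatten_runs.
have ut : uniq (t1 ++ t2).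
  by rewrite (perm_uniq pt); move: uw; rewrite cat_uniq => /and3P[].
have pw' : perm_eq (P ++ 1 :: t1 ++ 0 :: t2) (0 :: w).
  apply/permP => p; rewrite {1}Ew /=.
  have /permP/(_ p) := pt; rewrite !count_cat /= !count_cat /= => <-.
  by rewrite !(addnCA _ (nat_of_bool (p 0))).
rewrite (perm_normalize_cons pw pw') clean_left //; last first.
  by rewrite all_cat aP (perm_all _ pt); move: aw; rewrite all_cat => /andP[].
rewrite s1 s2 s12 size_map (perm_size pw') eqxx.
(* The letters following P form the same set as in [w], so the condition on P carries over. *)
rewrite (eq_clean (perm_mem pt) (p' := [::])) //.
rewrite cw rho_left //; last first.
  by rewrite all_cat aP (perm_all _ pt); move: aw; rewrite all_cat => /andP[].
by rewrite (sort_words pL sL) -Ew eqxx.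
Qed.

(* For p = size L the letter 1 becomes a last word of its own. *)
Definition insert_one (p : nat) (L : seq (seq nat)) : seq (seq nat) :=
  take p L ++ if drop p L is l :: R then (1 :: l) :: R else [:: [:: 1]].

Lemma flatten_insert_one p L :
  flatten (insert_one p L) = flatten (take p L) ++ 1 :: flatten (drop p L).
Proof. by rewrite flatten_cat; case: (drop p L). Qed.

Lemma size_insert_one p L : p <= size L ->
  size (insert_one p L) = size L + (p == size L).
Proof.
move=> pL; rewrite size_cat size_takel //.
by have := size_drop p L; case: (drop p L) => [|l R] /=; case: eqP; lia.
Qed.

Lemma word_gt_cons1 l l' :
  1 < max_word l -> word_gt l l' -> word_gt l (1 :: l').
Proof. by rewrite /word_gt {2}/max_word /= gtn_max => -> ->. Qed.

(** The letter 1 is below all others: put in front of a word it keeps it increasing with the same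
    maximum, and as a word of its own at the end it has the least maximum. *)
Lemma insert_one_words p L : increasing_words L -> sorted word_gt L ->
  all (ltn 1) (flatten L) ->
  increasing_words (insert_one p L) /\ sorted word_gt (insert_one p L).
Proof.
rewrite (sorted_pairwise word_gt_trans) => HL sL aL.
have {}aL : all (fun l => all (ltn 1) l) L.
  by elim: L aL {HL sL} => //= l L IH; rewrite all_cat => /andP[-> /IH].
split.
  move: HL aL; rewrite /increasing_words -{1 2}(cat_take_drop p L) !all_cat.
  case/andP=> -> HR /andP[_]; case: (drop p L) HR => [|[|x l] R] //=.
  by case/andP=> -> -> /andP[/andP[->]].
rewrite (sorted_pairwise word_gt_trans).
elim: L p HL sL aL => [|l L IH] p //=.
move=> /andP[/andP[l0 _] HL] /andP[lL sL] /andP[al aL].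
have l1 : 1 < max_word l by apply: (allP al); rewrite mem_max_word.
case: p => [|p].
  rewrite /insert_one /= sL andbT; apply/allP => l' /(allP lL).
  rewrite /word_gt => l'l; apply: leq_trans l'l _.
  by rewrite {2}/max_word /= leq_maxr.
rewrite /insert_one /= -/(insert_one p L) IH // andbT.
move: lL; rewrite -{1}(cat_take_drop p L) !all_cat => /andP[->].
case: (drop p L) => [_|l' R] /=.
  by rewrite /word_gt {1}/max_word /= maxn0 l1.
by case/andP=> ll' ->; rewrite word_gt_cons1.
Qed.

(** A later letter below all of [s] cannot be the 4. This discards the 1 that a child has after
    P. *)
Lemma clean_cons_min p m X s :
  all (ltn m) s -> clean p (m :: X) s = clean p X s.
Proof.
elim: s p => //= x s IH p /andP[mx ms]; rewrite IH //; congr andb.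
by case: s {IH ms} => // y s; rewrite !all_cat /= (ltnW mx).
Qed.

(** A cut inside an increasing word would put a larger letter right after the last letter of [B], so
    the cut falls between two words. *)
Lemma flatten_cut L B C : increasing_words L -> flatten L = B ++ C ->
  (forall B' x, B = rcons B' x -> all (geq x) C) ->
  exists p, [/\ p <= size L, B = flatten (take p L) & C = flatten (drop p L)].
Proof.
elim: L B => [|l L IH] B; first by case: B C => [|? ?] [|? ?] //; exists 0.
move=> /= /andP[/andP[_ sl] HL] EBC Hx.
case: (posnP (size B)) => [/size0nil B0|B0].
  by exists 0; move: EBC; rewrite B0.
have [lB|Bl] := leqP (size l) (size B).
  have EB : B = l ++ drop (size l) B.
    rewrite -{1}(cat_take_drop (size l) B); congr (_ ++ _).
    have := congr1 (take (size l)) EBC; rewrite take_size_cat // take_cat.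
    by case: ltngtP lB => // Es _ ->; rewrite Es subnn take0 cats0 take_size.
  move: (drop (size l) B) EB => B' EB; move: EBC; rewrite EB -catA => /eqP.
  rewrite eqseq_cat // eqxx => /eqP EL.
  have [|p [pL EB' EC]] := IH B' HL EL.
    by move=> B2 x EB2; apply: (Hx (l ++ B2) x); rewrite EB EB2 rcons_cat.
  by exists p.+1; rewrite /= -EB'.
(* Now [B] ends strictly inside [l]: the next letter [y] of [l] opens [C] and exceeds the last
   letter [x], against [Hx]. *)
exfalso; case/lastP: B EBC Hx B0 Bl => // B x EBC Hx _ Bl.
have El : l = rcons B x ++ drop (size (rcons B x)) l.
  rewrite -{1}(cat_take_drop (size (rcons B x)) l); congr (_ ++ _).
  have := congr1 (take (size (rcons B x))) EBC.
  by rewrite [in RHS]take_size_cat // take_cat Bl.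
move: Bl sl; case E: (drop _ l) El => [|y l'] El.
  by rewrite El cats0 ltnn.
move=> _; rewrite El cat_rcons => /(cat_sorted2 (s := B)) [_ /= /andP[xy _]].
have /allP/(_ y) := Hx B x erefl.
have -> : C = (y :: l') ++ flatten L.
  by move: EBC; rewrite El -catA => /eqP; rewrite eqseq_cat // eqxx => /eqP.
by rewrite mem_head => /(_ isT) /=; rewrite leqNgt xy.
Qed.

Lemma rem_cat_cons (T : eqType) (x : T) A B : x \notin A ->
  rem x (A ++ x :: B) = A ++ B.
Proof.
elim: A => [|a A IH] /=; first by rewrite eqxx.
by rewrite inE negb_or eq_sym => /andP[/negPf -> /IH ->].
Qed.

Lemma all_gt0 s : all (ltn 1) s -> all (ltn 0) s.
Proof. by apply: sub_all => x /=; lia. Qed.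

(** Deleting 1 from [t] must leave the concatenated last blocks, and avoidance allows 1 only at a
    boundary between blocks. *)
Lemma theta_right w A t : w \in S_nonempty -> all (ltn 1) A -> 1 \in t ->
  all (ltn 0) t ->
  (normalize (A ++ 0 :: t) \in theta w) <->
  A = before_one w /\
  exists2 p, p <= size (last_blocks w)
           & t = flatten (insert_one p (last_blocks w)).
Proof.
move=> wS aA t1 at0; have [[Ew aw uw] [cw Er sL]] := S_nonempty_cut wS.
have pw : is_permutation w by move: wS; rewrite !inE => /andP[/andP[]].
have HL : increasing_words (last_blocks w) by rewrite -Er increasing_words_runs.
set L := last_blocks w in Ew aw uw cw Er sL HL *.
set P := before_one w in Ew aw uw cw *.
move: aw uw; rewrite all_cat cat_uniq => /andP[aP aL] /and3P[uP _ uL].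
rewrite in_theta normalize_S; split.
  case/and3P=> /andP[pt ct] _ /eqP; rewrite rho_right // [in X in _ = X -> _]Ew.
  case/cat_cons_inj; rewrite ?(above_notin _ (leqnn 1)) // => -> Et; split=> //.
  have ut : uniq t.
    by have := perm_uniq pt; rewrite iota_uniq cat_uniq /= => /and4P[].
  case/splitPr: t1 at0 pt ct ut Et => B C at0 pt ct ut.
  have B1 : 1 \notin B.
    by move: ut; rewrite uniq_catC /= mem_cat negb_or => /andP[/andP[]].
  rewrite rem_cat_cons // => /esym EL.
  have [|p [pL EB EC]] := flatten_cut HL EL; last first.
    by exists p; rewrite // flatten_insert_one -EB -EC.
  (* The last letter [x] before 1 forms a descent with it, and 0 lies below this descent, so nothing
     after 1 may exceed [x]. *)
  move=> B' x EB; move: ct; rewrite clean_cat_min; last first.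
    by rewrite /= all_cat at0 all_gt0.
  case/andP=> _ /cleanP /(_ B' x 1 C); rewrite EB cat_rcons cats0; apply=> //.
    by rewrite has_cat orbT.
  move: at0 B1; rewrite EB all_cat all_rcons mem_rcons inE negb_or.
  by case: (x) => [|[|]].
case=> -> [p pL Et].
have [HI sI] := insert_one_words p HL sL aL.
have pt : perm_eq t (1 :: flatten L).
  rewrite Et flatten_insert_one -[in X in perm_eq _ X](cat_take_drop p L).
  by rewrite flatten_cat -[1 :: flatten _]cat1s perm_catCA.
have L1 : 1 \notin flatten L by apply: above_notin aL _.
have ut : uniq t by rewrite (perm_uniq pt) /= L1.
have pw' : perm_eq (P ++ 0 :: t) (0 :: w).
  rewrite -cat1s perm_catCA /= perm_cons [in X in perm_eq _ X]Ew perm_cat2l.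
  exact: pt.
rewrite (perm_normalize_cons pw pw') size_map (perm_size pw') eqxx rho_right //.
rewrite Et flatten_insert_one rem_cat_cons; last first.
  move: L1; rewrite -{1}(cat_take_drop p L) flatten_cat mem_cat negb_or.
  by case/andP.
rewrite -flatten_cat cat_take_drop -Ew eqxx -flatten_insert_one -Et !andbT.
rewrite clean_cat_min; last first.
  by rewrite /= all_cat at0 all_gt0.
rewrite cats0 clean_runs // Et runs_flatten // -?Et // sI.
rewrite (eq_clean (perm_mem pt) (p' := [::])) // clean_cons_min // cw.
by apply/allP.
Qed.

(** * Expansions as preimages of rho *)

Lemma nonlast_rcons L l : nonlast (rcons L l) = L.
Proof. by rewrite /nonlast size_rcons -cats1 take_size_cat. Qed.

(** Only the last word of [L1] is free to be smaller than words of [L2]. Positions count from 0: the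
    first [c] words stay, and the word at position [r] joins them. *)
Lemma splitsP L1 L2 L : sorted word_gt L ->
  reflect ((L1 = [::] /\ L2 = L) \/
    exists c r, [/\ c <= r, r < size L, L1 = rcons (take c L) (nth [::] L r)
                  & L2 = rem (nth [::] L r) (drop c L)])
    (splits L1 L2 L).
Proof.
move=> sL; have pwE := sorted_pairwise word_gt_trans.
apply: (iffP and4P) => [[pL s1 s2 s12]|].
  case/lastP: L1 pL s1 s12 => [|A x] pL s1 s12.
    by left; split=> //; apply: perm_sorted_words.
  right; rewrite nonlast_rcons in s12.
  have um : uniq (map max_word (A ++ x :: L2)).
    by rewrite -cat_rcons (perm_uniq (perm_map _ pL)) sorted_uniq_max.
  pose S := sort word_ge (x :: L2).
  have pS : perm_eq S (x :: L2) by rewrite perm_sort.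
  move: (um); rewrite map_cat cat_uniq => /and3P[_ /hasPn mA mS].
  (* Words of [A] exceed [x] because [L1] is sorted, and those of [L2] by [s12], strictly since
     maxima are distinct. So [A] followed by the sorted rest is in order. *)
  have EL : A ++ S = L.
    apply: perm_sorted_words => //.
      by rewrite -(permPr pL) cat_rcons perm_cat2l.
    move: s1; rewrite !pwE -cats1 !pairwise_cat => /and3P[Ax -> _].
    rewrite -pwE sort_word_gt //= andbT; apply/allrelP => a y aA.
    rewrite (perm_mem pS) inE => /predU1P[->|yL2].
      by apply: (allrelP Ax); rewrite // mem_head.
    rewrite /word_gt ltn_neqAle [_ <= _](allP (allP s12 a aA) y yL2) andbT.
    have /mA : max_word y \in map max_word (x :: L2).
      by apply: map_f; rewrite inE yL2 orbT.
    by apply: contraNneq => ->; apply: map_f.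
  have xS : x \in S by rewrite (perm_mem pS) mem_head.
  have Ex : nth [::] L (size A + index x S) = x.
    by rewrite -EL nth_cat ltnNge leq_addr /= addKn nth_index.
  exists (size A), (size A + index x S); rewrite Ex leq_addr -EL size_cat.
  rewrite ltn_add2l index_mem xS take_size_cat // drop_size_cat //; split=> //.
  apply: perm_sorted_words => //.
    by rewrite -(perm_cons x) -(permPl pS) perm_to_rem.
  by apply: (subseq_sorted word_gt_trans (rem_subseq _ _)); apply: sort_word_gt.
case=> [[-> ->]|[c [r [cr rL -> ->]]]]; first by [].
set x := nth _ _ _.
have xD : x \in drop c L.
  rewrite /x -(subnKC cr) -nth_drop; apply: mem_nth.
  by rewrite size_drop ltn_sub2r // (leq_ltn_trans cr).
have pD : perm_eq (x :: rem x (drop c L)) (drop c L).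
  by rewrite perm_sym perm_to_rem.
move: (sL); rewrite {1}pwE -{1}(cat_take_drop c L) pairwise_cat.
case/and3P=> Htd st sd.
rewrite nonlast_rcons; split.
- by rewrite cat_rcons -[X in perm_eq _ X](cat_take_drop c L) perm_cat2l.
- rewrite pwE -cats1 pairwise_cat st andbT; apply/allrelP => a y aT.
  by rewrite inE => /eqP ->; apply: (allrelP Htd).
- by apply: (subseq_sorted word_gt_trans (rem_subseq _ _)); rewrite pwE.
apply/allP => a aT; apply/allP => y /mem_rem yD.
exact: ltnW (allrelP Htd _ _ aT yD).
Qed.

Lemma map_last_block w p n :
  [seq last_block w r | r <- iota p.+1 n] =
  [seq nth [::] (last_blocks w) r | r <- iota p n].
Proof. by rewrite -[p.+1]add1n iotaDl -map_comp. Qed.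

Lemma last_word_take w q : q <= size (last_blocks w) ->
  last_word w 1 q = flatten (take q (last_blocks w)).
Proof.
by move=> qL; rewrite /last_word subn1 map_last_block map_nth_iota0.
Qed.

Lemma last_word_drop w p :
  last_word w p.+1 (size (last_blocks w)) = flatten (drop p (last_blocks w)).
Proof.
rewrite /last_word subSS map_last_block map_nth_iota //.
by rewrite -size_drop take_size.
Qed.

(** The empty factor is kept so that the word shows the form A 1 t1 0 t2 with t1 empty. *)
Lemma exp_topE w :
  exp_top w =
  normalize (before_one w ++ 1 :: [::] ++ 0 :: flatten (last_blocks w)).
Proof. by rewrite /exp_top /nb_last_blocks last_word_take // take_size. Qed.

Lemma exp_bracketE w p : p <= size (last_blocks w) ->
  exp_bracket w p.+1 =
  normalize (before_one w ++ 0 :: flatten (insert_one p (last_blocks w))).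
Proof.
move=> pL; rewrite /exp_bracket /nb_last_blocks subn1 last_word_drop.
by rewrite last_word_take // flatten_insert_one.
Qed.

(** Change of parameters: [c] words stay between 1 and the moved word, which has position [r]
    counted from 0. Thus i = k - c - 1 words remain after 0, and j = r - c + 1. *)
Lemma exp_pairE w c r (L := last_blocks w) : uniq L -> c <= r -> r < size L ->
  exp_pair w (size L - c.+1) (r - c).+1 =
  normalize (before_one w ++
    1 :: flatten (rcons (take c L) (nth [::] L r)) ++
    0 :: flatten (rem (nth [::] L r) (drop c L))).
Proof.
move=> uL cr rL; rewrite /exp_pair /nb_last_blocks -/L.
have -> : size L - (size L - c.+1) = c.+1 by lia.
have -> : c.+1 + (r - c).+1 - 1 = r.+1 by lia.
have -> : (size L - c.+1).+1 = size L - c by lia.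
rewrite subn1 /= last_word_take; last exact: leq_trans (ltnW rL).
rewrite flatten_rcons -catA /last_block /= -/L.
congr (normalize (_ ++ _ :: _ ++ _ ++ _ :: flatten _)).
(* The blocks are distinct, so removing the word at position [r] amounts to omitting its index. *)
rewrite rem_filter ?drop_uniq // -[drop c L](take_size) size_drop.
rewrite -(map_nth_iota [::]) // filter_map -[c.+1]add1n iotaDl filter_map.
rewrite -map_comp; congr map; apply: eq_in_filter => q.
rewrite mem_iota subnKC ?(leq_trans cr (ltnW rL)) // => /andP[_ qL] /=.
by rewrite add1n eqSS nth_uniq.
Qed.

Lemma normalizeE w : all (leq 1) w -> w = normalize (map predn w).
Proof. by elim: w => //= -[|x] w IH //= /IH <-. Qed.

Lemma theta_cut w s : w \in S_nonempty -> s \in theta w ->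
  (exists A t1 t2, all (ltn 1) (A ++ t1 ++ t2) /\
     s = normalize (A ++ 1 :: t1 ++ 0 :: t2)) \/
  (exists A t, [/\ all (ltn 1) A, 1 \in t, all (ltn 0) t
                 & s = normalize (A ++ 0 :: t)]).
Proof.
move=> wS; rewrite in_theta => /and3P[sS /eqP ss _].
(* Hence the child has length at least two and its unnormalized word contains both 0 and 1. *)
have w0 : 0 < size w by move: wS; rewrite inE => /andP[_]; case: (w).
have {sS} ps : is_permutation s by move: sS; rewrite inE => /andP[].
have Es : s = normalize (map predn s).
  apply: normalizeE; apply/allP => x; rewrite (perm_mem ps) mem_iota.
  by case/andP.
move: (map predn s) Es ps ss => t -> {s}.
rewrite is_permutation_normalize size_map => pt st; rewrite st in pt.
have ut : uniq t by rewrite (perm_uniq pt) iota_uniq.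
have t0 : 0 \in t by rewrite (perm_mem pt).
have t1 : 1 \in t by rewrite (perm_mem pt) mem_iota /= ltnS.
case/splitPr: t0 t1 ut {pt st} => A u uA.
rewrite uniq_catC /= mem_cat negb_or uniq_catC => /andP[/andP[u0 A0] ut].
have gt0 v : 0 \notin v -> all (ltn 0) v.
  by move=> v0; apply/allP => -[xv|//]; rewrite xv in v0.
have gt1 v : 0 \notin v -> 1 \notin v -> all (ltn 1) v.
  move=> v0 v1; apply/allP => -[xv|[xv|//]]; first by rewrite xv in v0.
  by rewrite xv in v1.
move: uA; rewrite mem_cat inE /=.
have [Ai _|A1 u1] := boolP (1 \in A); last first.
  by right; exists A, u; rewrite gt1 // gt0.
case/splitPr: Ai A0 ut => B v A0 ut.
left; exists B, v, u; rewrite -catA; split=> //.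
move: ut; rewrite -catA uniq_catC -catA /= !mem_cat !negb_or.
move: A0; rewrite mem_cat inE !negb_or => /and3P[B0 _ v0].
by case/andP=> /and3P[v1 u1 B1] _; rewrite !all_cat !gt1.
Qed.

(** Words taken from the last blocks in sorted order are the runs of their concatenation, so
    [theta_left] applies to lists of words. *)
Lemma theta_left_words w L1 L2 : w \in S_nonempty ->
  splits L1 L2 (last_blocks w) ->
  normalize (before_one w ++ 1 :: flatten L1 ++ 0 :: flatten L2) \in theta w.
Proof.
move=> wS HS; have [[_ aw uw] [_ Er _]] := S_nonempty_cut wS.
have /and4P[pL s1 s2 _] := HS.
have : increasing_words (L1 ++ L2).
  by rewrite /increasing_words (perm_all _ pL) -Er runs_increasing.
rewrite /increasing_words all_cat => /andP[H1 H2].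
have pF : perm_eq (flatten L1 ++ flatten L2) (flatten (last_blocks w)).
  by have := perm_flatten pL; rewrite flatten_cat.
have: uniq (flatten L1 ++ flatten L2).
  by rewrite (perm_uniq pF); move: uw; rewrite cat_uniq => /and3P[].
rewrite cat_uniq => /and3P[u1 _ u2].
rewrite theta_left // ?eqxx ?runs_flatten //.
by move: aw; rewrite !all_cat -(perm_all _ pF) all_cat.
Qed.

Lemma uniq_last_blocks w : w \in S_nonempty -> uniq (last_blocks w).
Proof.
by case/S_nonempty_cut=> _ [_ _ /sorted_uniq_max /map_uniq].
Qed.

Lemma exp_top_theta w : w \in S_nonempty -> exp_top w \in theta w.
Proof.
move=> wS; have [_ [_ _ sL]] := S_nonempty_cut wS.
rewrite exp_topE (theta_left_words (L1 := [::])) //.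
by apply/splitsP => //; left.
Qed.

Lemma exp_pair_theta w c r : w \in S_nonempty -> c <= r ->
  r < size (last_blocks w) ->
  exp_pair w (size (last_blocks w) - c.+1) (r - c).+1 \in theta w.
Proof.
move=> wS cr rL; have [_ [_ _ sL]] := S_nonempty_cut wS.
rewrite exp_pairE ?uniq_last_blocks // theta_left_words //.
by apply/splitsP => //; right; exists c, r.
Qed.

Lemma insert_one_theta w p (t := flatten (insert_one p (last_blocks w))) :
  w \in S_nonempty -> p <= size (last_blocks w) ->
  normalize (before_one w ++ 0 :: t) \in theta w /\
  runs t = insert_one p (last_blocks w).
Proof.
move=> wS pL; have [[_ aw uw] [_ Er sL]] := S_nonempty_cut wS.
move: aw uw; rewrite all_cat cat_uniq => /andP[aP aL] /and3P[_ _ uL].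
have HL : increasing_words (last_blocks w) by rewrite -Er increasing_words_runs.
have [HI sI] := insert_one_words p HL sL aL.
have pt : perm_eq t (1 :: flatten (last_blocks w)).
  rewrite /t flatten_insert_one.
  rewrite -[in X in perm_eq _ X](cat_take_drop p (last_blocks w)).
  by rewrite flatten_cat -[1 :: flatten _]cat1s perm_catCA.
split; last first.
  by rewrite runs_flatten // -/t (perm_uniq pt) /= uL (above_notin aL).
apply/theta_right => //.
- by rewrite (perm_mem pt) mem_head.
- by rewrite (perm_all _ pt) /= all_gt0.
by split=> //; exists p.
Qed.

Lemma exp_bracket_theta w p : w \in S_nonempty -> p <= size (last_blocks w) ->
  exp_bracket w p.+1 \in theta w.
Proof.
by move=> wS pL; rewrite exp_bracketE //; case: (insert_one_theta wS pL).
Qed.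

Lemma thetaP w s : w \in S_nonempty ->
  s \in theta w <->
  [\/ s = exp_top w,
      exists i j, [/\ i < ell w, 1 <= j, j <= i.+1 & s = exp_pair w i j]
    | exists p, [/\ 1 <= p, p <= (ell w).+1 & s = exp_bracket w p]].
Proof.
move=> wS; rewrite ell_last_blocks //; set k := size _; split; last first.
  case=> [->|[i [j [ik j1 ji ->]]]|[[|p] [//= _ pk ->]]].
  - exact: exp_top_theta.
  (* The change of parameters is inverted by c = k - i - 1 and r = c + j - 1. *)
  - have -> : i = k - (k - i.+1).+1 by lia.
    have -> : j = (k - i.+1 + j.-1 - (k - i.+1)).+1 by lia.
    by apply: exp_pair_theta => //; rewrite -/k; lia.
  - exact: exp_bracket_theta.
have [[_ _ uw] [_ Er sL]] := S_nonempty_cut wS.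
move=> sw; case: (theta_cut wS sw) (sw).
  case=> [A [t1 [t2 [a12 ->]]]].
  rewrite theta_left // => /andP[/eqP -> /(splitsP _ _ sL)].
  case=> [[E1 E2]|[c [r [cr rk E1 E2]]]].
    have -> : t1 = [::] by rewrite -(flatten_runs t1) E1.
    by constructor 1; rewrite exp_topE -E2 flatten_runs.
  constructor 2; exists (k - c.+1), (r - c).+1; split=> //.
  1, 2: by rewrite /k; lia.
  by rewrite exp_pairE ?uniq_last_blocks // -E1 -E2 !flatten_runs.
case=> [A [t [aA t1 t0 ->]]]; case/theta_right => // -> [p pk ->].
by constructor 3; exists p.+1; rewrite exp_bracketE.
Qed.

(** * Labels of the expansions *)

Lemma ell_normalize w A t : normalize (A ++ 0 :: t) \in theta w ->
  all (ltn 0) A -> ell (normalize (A ++ 0 :: t)) = size (runs t).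
Proof.
rewrite in_theta => /and3P[sS _ _] aA.
(* Normalization turns 0 into the entry 1, so the last blocks of the child are the raised runs of
   [t]. *)
rewrite ell_last_blocks; last by rewrite inE sS; case: (A).
rewrite /normalize map_cat last_blocks_cat ?runs_map_succ ?size_map ?all_map //.
exact/allP.
Qed.

Lemma ell_exp_top w : w \in S_nonempty -> ell (exp_top w) = ell w.
Proof.
move=> wS; have := exp_top_theta wS.
have [[_ aw _] [_ Er _]] := S_nonempty_cut wS.
rewrite exp_topE -cat1s catA => /ell_normalize ->.
  by rewrite Er ell_last_blocks.
by move: aw; rewrite !all_cat => /andP[/all_gt0 -> _].
Qed.

Lemma ell_exp_pair w i j :
  w \in S_nonempty -> i < ell w -> 1 <= j -> j <= i.+1 ->
  ell (exp_pair w i j) = i.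
Proof.
move=> wS; rewrite ell_last_blocks //; set k := size _ => ik j1 ji.
have [[_ aw uw] [_ Er sL]] := S_nonempty_cut wS.
pose c := k - i.+1; pose r := c + j.-1.
have cr : c <= r by rewrite leq_addr.
have rk : r < size (last_blocks w) by rewrite /r /c -/k; lia.
have -> : i = k - c.+1 by rewrite /c; lia.
have -> : j = (r - c).+1 by rewrite /r; lia.
have := exp_pair_theta wS cr rk; rewrite exp_pairE ?uniq_last_blocks //.
set x := nth _ _ _; set L1 := rcons _ _; set L2 := rem _ _.
have /and4P[pL s1 s2 _] : splits L1 L2 (last_blocks w).
  by apply/splitsP => //; right; exists c, r.
have : increasing_words (L1 ++ L2).
  by rewrite /increasing_words (perm_all _ pL) -Er runs_increasing.
rewrite /increasing_words all_cat => /andP[H1 H2].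
have pF : perm_eq (flatten L1 ++ flatten L2) (flatten (last_blocks w)).
  by have := perm_flatten pL; rewrite flatten_cat.
rewrite -cat_cons catA => /ell_normalize ->; last first.
  move: aw; rewrite !all_cat -(perm_all _ pF) all_cat /=.
  by case/and3P=> /all_gt0 -> /all_gt0 ->.
rewrite runs_flatten //; last first.
  move: uw; rewrite cat_uniq -(perm_uniq pF) cat_uniq => /and3P[_ _].
  by case/and3P.
(* [L1] takes c + 1 of the k words, which leaves k - (c + 1) runs after 0. *)
have := perm_size pL; rewrite size_cat size_rcons size_takel; last first.
  exact: leq_trans (ltnW rk).
by rewrite -/k => <-; rewrite addKn.
Qed.

Lemma ell_exp_bracket w p : w \in S_nonempty -> p <= ell w ->
  ell (exp_bracket w p.+1) = ell w + (p == ell w).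
Proof.
move=> wS; rewrite (ell_last_blocks wS) => pL.
have [[_ aw _] _] := S_nonempty_cut wS.
have [tw Er] := insert_one_theta wS pL.
rewrite exp_bracketE // (ell_normalize tw) ?Er ?size_insert_one //.
by move: aw; rewrite all_cat => /andP[/all_gt0].
Qed.

(** * Distinctness of the expansions *)

(** For fixed i the words agree up to the moved block, which ends at the only 0; so the block, and
    with it its index, can be read off. *)
Lemma exp_pair_inj w i j j' : w \in S_nonempty -> i < ell w ->
  1 <= j <= i.+1 -> 1 <= j' <= i.+1 ->
  exp_pair w i j = exp_pair w i j' -> j = j'.
Proof.
move=> wS; rewrite (ell_last_blocks wS); set k := size _ => ik Hj Hj'.
have [[_ aw _] _] := S_nonempty_cut wS.
pose c := k - i.+1.
have -> : i = k - c.+1 by rewrite /c; lia.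
have rk b : 1 <= b <= i.+1 -> c + b.-1 < k by rewrite /c; lia.
have -> : j = (c + j.-1 - c).+1 by rewrite addKn prednK //; case/andP: Hj.
have -> : j' = (c + j'.-1 - c).+1 by rewrite addKn prednK //; case/andP: Hj'.
rewrite !exp_pairE ?uniq_last_blocks ?leq_addr ?rk //.
move/(inj_map succn_inj)/eqP; rewrite eqseq_cat // eqxx /= eqseq_cons eqxx /=.
rewrite !flatten_rcons -!catA eqseq_cat // eqxx /= => /eqP.
have n0 b : 1 <= b <= i.+1 -> 0 \notin nth [::] (last_blocks w) (c + b.-1).
  move=> /rk bk; move: aw; rewrite all_cat.
  move=> /andP[_ /above_notin/(_ (leq0n 1))].
  apply: contra => xn; apply/flattenP.
  by exists (nth [::] (last_blocks w) (c + b.-1)); rewrite ?mem_nth.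
case/cat_cons_inj; rewrite ?n0 // => /eqP + _.
by rewrite nth_uniq ?uniq_last_blocks ?rk // eqn_add2l => /eqP ->.
Qed.

(** Recovers the insertion place from the list of runs, as the place of the run holding 1. *)
Lemma find_insert_one p L : p <= size L -> all (ltn 1) (flatten L) ->
  find (fun l => 1 \in l) (insert_one p L) = p.
Proof.
move=> pL aL; rewrite find_cat ifF ?size_takel //; last first.
  apply/hasP => -[l lL l1]; have /negP := above_notin aL (leqnn 1); apply.
  by apply/flattenP; exists l => //; apply: mem_take lL.
by case: (drop p L) => [|l R] /=; rewrite addn0.
Qed.

Lemma exp_bracket_inj w p p' : w \in S_nonempty -> p <= ell w -> p' <= ell w ->
  exp_bracket w p.+1 = exp_bracket w p'.+1 -> p = p'.
Proof.
move=> wS; rewrite (ell_last_blocks wS) => pL pL'.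
have [[_ aw uw] [_ Er sL]] := S_nonempty_cut wS.
rewrite !exp_bracketE // => /(inj_map succn_inj)/eqP.
rewrite eqseq_cat // eqxx /= eqseq_cons eqxx /= => /eqP.
move/(congr1 runs); have [_ ->] := insert_one_theta wS pL.
have [_ ->] := insert_one_theta wS pL'.
move/(congr1 (find (fun l => 1 \in l))).
by move: aw; rewrite all_cat => /andP[_ aL]; rewrite !find_insert_one.
Qed.

(** * Counting children by label *)

Lemma card_fset_uniq (T : choiceType) (F : {fset T}) (s : seq T) :
  uniq s -> (forall x, x \in F <-> x \in s) -> #|` F| = size s.
Proof.
move=> us Fs; have -> : F = [fset x in s]%fset.
  by apply/fsetP => x; rewrite in_fset; apply/idP/idP => /Fs.
by rewrite card_fseq undup_id.
Qed.

Lemma mem_theta_ell w n s :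
  s \in [fset s in theta w | ell s == n]%fset = (s \in theta w) && (ell s == n).
Proof. by rewrite !inE. Qed.

(** [exp_top] and the brackets have labels at least k, so only the pairs with first index i count,
    one for each j from 1 to i + 1. *)
Lemma theta_ell_lt w i : w \in S_nonempty -> i < ell w ->
  #|` [fset s in theta w | ell s == i]%fset| = i.+1.
Proof.
move=> wS ik.
rewrite (@card_fset_uniq _ _ [seq exp_pair w i j | j <- iota 1 i.+1]).
- by rewrite size_map size_iota.
- rewrite map_inj_in_uniq ?iota_uniq // => j j'; rewrite !mem_iota => jP j'P.
  by apply: exp_pair_inj => //; lia.
move=> s; rewrite mem_theta_ell; split.
  case/andP=> /thetaP -/(_ wS)[->|[i' [j [i'k j1 ji ->]]]|[[|p] [//= _ pk ->]]].
  - by rewrite ell_exp_top // => /eqP; lia.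
  - rewrite ell_exp_pair // => /eqP <-; apply: map_f; rewrite mem_iota; lia.
  by rewrite ell_exp_bracket // => /eqP; lia.
case/mapP=> j; rewrite mem_iota => /andP[j1 ji] ->.
rewrite ell_exp_pair ?eqxx ?andbT //; apply/thetaP => //.
by constructor 2; exists i, j.
Qed.

(** Label k belongs to [exp_top] and to the k brackets that put 1 in front of an existing block. *)
Lemma theta_ell_eq w : w \in S_nonempty ->
  #|` [fset s in theta w | ell s == ell w]%fset| = (ell w).+1.
Proof.
move=> wS.
rewrite (@card_fset_uniq _ _
  (exp_top w :: [seq exp_bracket w p.+1 | p <- iota 0 (ell w)])).
- by rewrite /= size_map size_iota.
- rewrite /= map_inj_in_uniq ?iota_uniq; last first.
    move=> p p'; rewrite !mem_iota => /andP[_ pk] /andP[_ p'k].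
    by apply: exp_bracket_inj => //; apply: ltnW.
  rewrite andbT; apply/negP => /mapP[p]; rewrite mem_iota => /andP[_ /ltnW pk].
  (* After the common prefix P one word continues with 1 and the other with 0. *)
  rewrite exp_topE exp_bracketE -?ell_last_blocks //.
  by move=> /(inj_map succn_inj)/eqP; rewrite eqseq_cat // eqxx.
move=> s; rewrite mem_theta_ell; split.
  case/andP=> /thetaP -/(_ wS)[->|[i [j [ik j1 ji ->]]]|[[|p] [//= _ pk ->]]].
  - by rewrite mem_head.
  - by rewrite ell_exp_pair // => /eqP; lia.
  rewrite ell_exp_bracket // => Hp; rewrite inE; apply/orP; right.
  apply: (map_f (fun p => exp_bracket w p.+1)); rewrite mem_iota.
  by move: Hp; case: eqP => [|_ /eqP]; lia.
rewrite inE => /predU1P[->|/mapP[p]].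
  by rewrite ell_exp_top // eqxx andbT exp_top_theta.
rewrite mem_iota => /andP[_ pk] ->.
rewrite exp_bracket_theta // -?ell_last_blocks // ?(ltnW pk) //.
by rewrite ell_exp_bracket ?(ltnW pk) // (ltn_eqF pk) addn0 eqxx.
Qed.

(** Only the bracket placing 1 at the very end creates an additional run. *)
Lemma theta_ell_succ w : w \in S_nonempty ->
  #|` [fset s in theta w | ell s == (ell w).+1]%fset| = 1.
Proof.
move=> wS; rewrite (@card_fset_uniq _ _ [:: exp_bracket w (ell w).+1]) //.
move=> s; rewrite mem_theta_ell mem_seq1; split.
  case/andP=> /thetaP -/(_ wS)[->|[i [j [ik j1 ji ->]]]|[[|p] [//= _ pk ->]]].
  - by rewrite ell_exp_top // => /eqP; lia.
  - by rewrite ell_exp_pair // => /eqP; lia.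
  by rewrite ell_exp_bracket //; case: (p =P ell w) => [-> //|_ /eqP]; lia.
move=> /eqP ->; rewrite ell_exp_bracket // eqxx addn1 eqxx andbT.
by rewrite exp_bracket_theta // -ell_last_blocks.
Qed.

Lemma theta_ell_le w s :
  w \in S_nonempty -> s \in theta w -> ell s <= (ell w).+1.
Proof.
move=> wS /thetaP -/(_ wS)[->|[i [j [ik j1 ji ->]]]|[[|p] [//= _ pk ->]]].
- by rewrite ell_exp_top.
- by rewrite ell_exp_pair //; lia.
by rewrite ell_exp_bracket //; case: eqP; lia.
Qed.

Theorem theorem5p1 :
  (forall pi : seq nat, pi \in S_nonempty -> ell pi = 0 ->
     theta pi = [fset exp_top pi; exp_bracket pi 1]%fset) /\
  (forall pi : seq nat, pi \in S_nonempty -> 1 <= ell pi ->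
     forall sigma : seq nat,
       sigma \in theta pi <->
       [\/ sigma = exp_top pi,
           exists i j : nat, [/\ i <= ell pi - 1, 1 <= j, j <= i.+1
                               & sigma = exp_pair pi i j]
         | exists p : nat, [/\ 1 <= p, p <= (ell pi).+1
                             & sigma = exp_bracket pi p]]) /\
  is_Omega_labelling T_theta ell.
Proof.
split; [|split].
- move=> w wS k0; apply/fsetP => s; rewrite in_fset2; apply/idP/idP.
    (* For k = 0 there is no index i < k, and p can only be 1. *)
    case/thetaP => // [->|[i [j []]]|[p [p1 pk ->]]]; rewrite ?eqxx ?k0 //.
    by have -> : p = 1; [lia|rewrite eqxx orbT].
  by case/orP=> /eqP ->; rewrite ?exp_top_theta ?exp_bracket_theta.
- move=> w wS k1 s; rewrite thetaP //.
  have E i : (i <= ell w - 1) = (i < ell w) by lia.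
  split=> -[->|[i [j H]]|H]; [by constructor 1| |by constructor 3
                             |by constructor 1| |by constructor 3].
    by constructor 2; exists i, j; rewrite E.
  by constructor 2; exists i, j; rewrite -E.
split=> // w wS; split.
- move=> i; rewrite leq_eqVlt => /predU1P[->|ik]; first exact: theta_ell_eq.
  exact: theta_ell_lt.
- exact: theta_ell_succ.
by move=> s; apply: theta_ell_le.
Qed.
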